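(* Let $G=(V,E)$ be a finite undirected unweighted graph (all conductances equal to $1$) with $n\ge 2$ vertices and $m\ge1$ edges, and fix an arbitrary orientation of each edge. For an edge $e$, let $i_e\in\mathbb{R}^E$ be the unit electric current flow from the tail $e^-$ to the head $e^+$ of $e$, i.e. $i_e=BL^+b_e$ in the notation below. Then $$\frac{1}{m}\sum_{e\in E}\|i_e\|_1\le 2\log n,$$ where $\log$ is the natural logarithm.
   Context: For a vertex $v$, $\mathbbm{1}_v\in\mathbb{R}^V$ is the standard basis vector. For an edge $e$ oriented from $e^-$ to $e^+$, $b_e:=\mathbbm{1}_{e^+}-\mathbbm{1}_{e^-}$. $B\in\mathbb{R}^{E\times V}$ is the signed incidence matrix whose row indexed by $e$ is $b_e^\top$. The Laplacian is $L=B^\top B$ (unweighted case) and $L^+$ is its Moore–Penrose pseudoinverse. The vector $i_e$ gives, for each edge $f$, the current $i_e(f)$ flowing on $f$ (in its chosen orientation) when a unit current is sent between the endpoints of $e$. Graphs have no self-loops; parallel edges are allowed. *)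

(* Defs.v *)
From HB Require Import structures.
From mathcomp Require Import all_boot all_order all_algebra.
From mathcomp Require Import reals exp.
Set Implicit Arguments. Unset Strict Implicit. Unset Printing Implicit Defensive.
Import Order.TTheory GRing.Theory Num.Theory.
Local Open Scope ring_scope.

(* A multigraph on vertices 'I_n with edges 'I_m; edge e is oriented from
   [tail e] to [head e]. *)

Definition loopless (n m : nat) (tail head : 'I_m -> 'I_n) : Prop :=
  forall e, tail e != head e.

Definition bvec (R : realType) (n m : nat) (tail head : 'I_m -> 'I_n)
  (e : 'I_m) : 'cV[R]_n :=
  \col_v ((v == head e)%:R - (v == tail e)%:R).

Definition incidence (R : realType) (n m : nat) (tail head : 'I_m -> 'I_n)
  : 'M[R]_(m, n) :=
  \matrix_(e, v) ((v == head e)%:R - (v == tail e)%:R).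

Definition laplacian (R : realType) (n m : nat) (tail head : 'I_m -> 'I_n)
  : 'M[R]_n :=
  (incidence R tail head)^T *m incidence R tail head.

(* X is the Moore-Penrose pseudoinverse of A (real case: the four Penrose
   equations; such an X exists and is unique). *)
Definition moore_penrose (R : realType) (n : nat) (A X : 'M[R]_n) : Prop :=
  [/\ A *m X *m A = A, X *m A *m X = X,
      (A *m X)^T = A *m X & (X *m A)^T = X *m A].

Definition elec_flow (R : realType) (n m : nat) (tail head : 'I_m -> 'I_n)
  (Lp : 'M[R]_n) (e : 'I_m) : 'cV[R]_m :=
  incidence R tail head *m Lp *m bvec R tail head e.

Definition norm1 (R : realType) (m : nat) (x : 'cV[R]_m) : R :=
  \sum_(f < m) `|x f 0|.

(* Main.v *)
(* Let D be the diagonal matrix of degrees and k_t(u, v) the heat kernel of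
   D^-1 L divided by deg v, so that
     L^+ = int_0^oo k_t dt = 2 int_0^oo k_s D k_s ds
   when tested against the vectors b_e.  Hence sum_e ||i_e||_1 is at most
     2 int sum_v deg(v) (sum_e |b_e . k_s(., v)|)^2 ds.
   By Cauchy-Schwarz the square is at most
     (sum_e (k(e+) - k(e-))^2 / (k(e+) + k(e-))) * (sum_e (k(e+) + k(e-))),
   where the last factor is the total mass, 1, and the first one is at most half
   of the entropy production
     sum_e (k(e+) - k(e-)) (ln k(e+) - ln k(e-)).
   Integrated over time, the entropy started at v grows by at most
   ln (2m) - ln (deg v), and sum_v deg(v) (ln (2m) - ln (deg v)) <= 2m ln n.

   Time is discretised by the implicit Euler scheme with step eps: by concavity,
   the entropy gain of a step dominates the production at its endpoint, and the
   resolvent series still sums exactly to L^+.  Adding eps to every degree makes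
   D invertible; eps tends to 0 at the end. *)

Require Import Defs.
From HB Require Import structures.
From mathcomp Require Import all_boot all_order all_algebra.
From mathcomp Require Import reals exp.
From mathcomp Require Import normedtype derive.
From mathcomp Require Import ring lra.
Import Order.TTheory GRing.Theory Num.Theory.
Import numFieldNormedType.Exports.
Local Open Scope ring_scope.

(** * Inequalities for the logarithm *)

Lemma ln_le_subr1 (R : realType) (x : R) : 0 < x -> ln x <= x - 1.
Proof.
move=> x0; have -> : x = 1 + (x - 1) by rewrite addrC subrK.
by rewrite [1 + _ - 1]addrC addKr le_ln1Dx // ltrBDl addrN.
Qed.

(** Convexity of [x ln x], from [ln t <= t - 1] at [t = y / x]. The endpoint [x = 0] is kept because
    densities may vanish. *)
Lemma xlnx_tangent (R : realType) (x y : R) : 0 <= x -> 0 < y ->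
  (ln y + 1) * (x - y) <= x * ln x - y * ln y.
Proof.
rewrite le_eqVlt => /predU1P[<-|x0] y0.
  by rewrite mul0r; lra.
have yx0 : 0 < y / x by rewrite divr_gt0.
have := ln_le_subr1 _ _ yx0; rewrite ln_div ?posrE // => h.
have : x * (ln y - ln x) <= y - x.
  have -> : y - x = x * (y / x - 1) by field; rewrite gt_eqF.
  by rewrite ler_pM2l.
lra.
Qed.

(** The difference of the two sides vanishes at 1, and its derivative [ln x + 1/x - 1] is
    nonnegative by [ln_le_subr1] at [1/x]. *)
Lemma ln_ge_pade (R : realType) (t : R) : 1 <= t ->
  2 * (t - 1) <= (t + 1) * ln t.
Proof.
move=> t1.
pose f (x : R) := (x + 1) * ln x - 2 * (x - 1).
pose df (x : R) := ln x + x^-1 - 1.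
have fd (x : R) : 0 < x -> is_derive x 1 f (df x).
  move=> x0; have lnd := is_derive1_ln x0.
  apply: is_derive_eq.
  rewrite /GRing.scale /= /df; field.
  by rewrite gt_eqF.
have df0 x : 0 < x -> 0 <= df x.
  move=> x0; have := ln_le_subr1 _ x^-1; rewrite invr_gt0 => /(_ x0).
  by rewrite lnV ?posrE // /df; lra.
suff : f 1 <= f t by rewrite /f ln1; lra.
apply: (@ger0_derive1_ndecr _ f 1 t) => //.
- move=> x; rewrite in_itv /= => /andP[x1 _].
  by have [] := fd x (lt_trans ltr01 x1).
- move=> x; rewrite in_itv /= => /andP[x1 _].
  have x0 := lt_trans ltr01 x1.
  by rewrite derive1E; have [_ ->] := fd x x0; apply: df0.
- apply: derivable_within_continuous => x; rewrite in_itv /= => /andP[x1 _].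
  by have [] := fd x (lt_le_trans ltr01 x1).
Qed.

(** The logarithmic mean is at most the arithmetic mean: [ln_ge_pade] at [x / y], cleared of
    denominators. *)
Lemma log_mean_ge (R : realType) (x y : R) : 0 < x -> 0 < y ->
  2 * (x - y) ^+ 2 <= (x + y) * ((ln x - ln y) * (x - y)).
Proof.
wlog xy : x y / y <= x.
  move=> W x0 y0; have [/W|/ltW/W] := leP y x; first exact.
  by move=> /(_ y0 x0); lra.
move=> x0 y0.
have := @ln_ge_pade R (x / y); rewrite ler_pdivlMr // mul1r => /(_ xy).
rewrite ln_div ?posrE // => h.
have : y * (x - y) * (2 * (x / y - 1)) <= y * (x - y) * ((x / y + 1) * (ln x - ln y)).
  by apply: ler_wpM2l h; apply: mulr_ge0; [exact: ltW | rewrite subr_ge0].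
have -> : y * (x - y) * (2 * (x / y - 1)) = 2 * (x - y) ^+ 2 by field; rewrite gt_eqF.
suff -> : y * (x - y) * ((x / y + 1) * (ln x - ln y))
   = (x + y) * ((ln x - ln y) * (x - y)) by [].
by field; rewrite gt_eqF.
Qed.

(* AM-GM: 2 l |x - y| - l^2 (x + y) <= (x - y)^2 / (x + y). *)
Lemma log_mean_ge_linear (R : realType) (l x y : R) : 0 < x -> 0 < y ->
  2 * (2 * l * `|x - y| - l ^+ 2 * (x + y)) <= (ln x - ln y) * (x - y).
Proof.
move=> x0 y0; have s0 : 0 < x + y by rewrite addr_gt0.
rewrite -(ler_pM2l s0); apply: le_trans (log_mean_ge _ _ _ x0 y0).
rewrite -(real_normK (num_real (x - y))).
have := sqr_ge0 (`|x - y| - l * (x + y)); nra.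
Qed.

(** * Edge sums and the Laplacian *)

Section Graph.
Context {R : realType} {n m : nat}.
Variables (tail head : 'I_m -> 'I_n).
Implicit Types (k : 'I_n -> R) (e : 'I_m) (u v : 'I_n).

Local Notation B := (incidence R tail head).

Definition degree v : R := \sum_e ((v == head e)%:R + (v == tail e)%:R).

(** The coordinate [u] of [L k], kept as a sum over edges so that signs can be read edge by edge. *)
Definition edge_lap k u : R := \sum_e B e u * (k (head e) - k (tail e)).

Definition variation k : R := \sum_e `|k (head e) - k (tail e)|.

Lemma sum_delta k u : \sum_v (v == u)%:R * k v = k u.
Proof.
rewrite (bigD1 u) //= eqxx mul1r big1 ?addr0 // => v /negbTE ->.
by rewrite mul0r.
Qed.

Lemma sum_incidence k e : \sum_v B e v * k v = k (head e) - k (tail e).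
Proof.
under eq_bigr => v _ do rewrite mxE mulrBl.
by rewrite sumrB !sum_delta.
Qed.

Lemma degree_ge0 v : 0 <= degree v.
Proof. by apply: sumr_ge0 => e _; rewrite addr_ge0 ?ler0n. Qed.

Lemma sum_degree k :
  \sum_v degree v * k v = \sum_e (k (head e) + k (tail e)).
Proof.
under eq_bigr => v _ do rewrite mulr_suml.
rewrite exchange_big /=; apply: eq_bigr => e _.
under eq_bigr => v _ do rewrite mulrDl.
by rewrite big_split /= !sum_delta.
Qed.

(** Summation by parts: both sides are the Dirichlet form of [w] and [k]. *)
Lemma sum_edge_lap (w k : 'I_n -> R) : \sum_u w u * edge_lap k u =
  \sum_e (w (head e) - w (tail e)) * (k (head e) - k (tail e)).
Proof.
under eq_bigr => u _ do rewrite mulr_sumr.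
rewrite exchange_big /=; apply: eq_bigr => e _.
rewrite -(sum_incidence w) mulr_suml; apply: eq_bigr => u _.
by rewrite mulrA [w u * _]mulrC.
Qed.

(** Stated per edge because [euler_step_support] needs every term to vanish, not only their sum. *)
Lemma edge_lap_min_term k u e : (forall w, k u <= k w) ->
  B e u * (k (head e) - k (tail e)) <= 0.
Proof.
move=> kmin; rewrite mxE.
have [uh|_] := eqVneq u (head e); have [ut|_] := eqVneq u (tail e).
- by rewrite subrr mul0r.
- by rewrite subr0 mul1r subr_le0 -uh.
- by rewrite sub0r mulN1r oppr_le0 subr_ge0 -ut.
- by rewrite subrr mul0r.
Qed.

(** * Implicit Euler steps and their entropy *)

Section Euler.
Variable eps : R.
Hypothesis eps_gt0 : 0 < eps.

Definition mass v : R := degree v + eps.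

(* D k = (D + eps L) k', i.e. an implicit Euler step for k_t' = - D^-1 L k_t. *)
Definition euler_step (k k' : 'I_n -> R) : Prop :=
  forall u, mass u * k u = mass u * k' u + eps * edge_lap k' u.

Definition entropy k : R := - \sum_v mass v * (k v * ln (k v)).

Lemma mass_gt0 v : 0 < mass v.
Proof. by rewrite ltr_wpDl // degree_ge0. Qed.

Lemma sum_mass : \sum_v mass v = 2 * m%:R + n%:R * eps.
Proof.
rewrite big_split /= sumr_const card_ord [n%:R * _]mulr_natl; congr (_ + _).
transitivity (\sum_v degree v * 1); first by apply: eq_bigr => v _; rewrite mulr1.
by rewrite (sum_degree (fun=> 1)) sumr_const card_ord mulr_natr.
Qed.

Lemma variation_le_mass k : (forall v, 0 <= k v) ->
  variation k <= \sum_v mass v * k v.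
Proof.
move=> k0; apply: (@le_trans _ _ (\sum_v degree v * k v)); last first.
  apply: ler_sum => v _; rewrite ler_wpM2r // lerDl; exact: ltW.
rewrite sum_degree; apply: ler_sum => e _.
by apply: le_trans (ler_normB _ _) _; rewrite !ger0_norm.
Qed.

(** Minimum principle: at a minimiser [u] of [k'] the Laplacian term is nonpositive, so [k' u < 0]
    would make [mass u * k u] negative. *)
Lemma euler_step_ge0 k k' : euler_step k k' ->
  (forall v, 0 <= k v) -> forall v, 0 <= k' v.
Proof.
move=> st k0 v.
case: (@arg_minP _ R _ v xpredT k' isT) => u _ umin.
apply: le_trans (umin v isT); rewrite leNgt; apply/negP => ku.
have : edge_lap k' u <= 0.
  by apply: sumr_le0 => e _; apply: edge_lap_min_term => w; apply: umin.
move=> h; have := st u; apply/eqP; rewrite gt_eqF //.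
apply: (@lt_le_trans _ _ 0); last by rewrite mulr_ge0 // ltW // mass_gt0.
by rewrite ltr_wnDr ?nmulr_llt0 ?mass_gt0 // pmulr_rle0.
Qed.

(* Needed since ln 0 = 0 would break the entropy bound across an edge with
   exactly one endpoint in the support of k'. *)
Lemma euler_step_support k k' : euler_step k k' -> (forall v, 0 <= k v) ->
  forall e, k' (head e) = 0 <-> k' (tail e) = 0.
Proof.
move=> st k0; have k'0 := euler_step_ge0 _ _ st k0.
(* A zero of [k'] is a minimum, so every edge term there is nonpositive; the step equation makes
   their sum nonnegative, hence all vanish. *)
have flat u e : k' u = 0 -> B e u * (k' (head e) - k' (tail e)) = 0.
  move=> ku.
  have le0 f : B f u * (k' (head f) - k' (tail f)) <= 0.
    by apply: edge_lap_min_term => w; rewrite ku.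
  have ge0 : 0 <= edge_lap k' u.
    have := st u; rewrite ku mulr0 add0r => h.
    by rewrite -(pmulr_rge0 _ eps_gt0) -h mulr_ge0 // ltW // mass_gt0.
  have eq0 : edge_lap k' u = 0.
    by apply/eqP; rewrite eq_le ge0 andbT; apply: sumr_le0.
  have ge0' f : true -> 0 <= - (B f u * (k' (head f) - k' (tail f))).
    by rewrite oppr_ge0.
  apply/eqP; rewrite -oppr_eq0; apply/eqP; apply: (psumr_eq0P ge0') => //.
  by rewrite sumrN -/(edge_lap k' u) eq0 oppr0.
move=> e; have [->//|ht] := eqVneq (head e) (tail e).
split=> z; have := flat _ e z; rewrite mxE eqxx.
  by rewrite (negbTE ht) subr0 mul1r z sub0r => /eqP; rewrite oppr_eq0 => /eqP.
by rewrite eq_sym (negbTE ht) sub0r mulN1r z subr0 => /eqP; rewrite oppr_eq0 => /eqP.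
Qed.

Lemma euler_step_mass k k' : euler_step k k' ->
  \sum_v mass v * k' v = \sum_v mass v * k v.
Proof.
move=> st; under [RHS]eq_bigr => v _ do rewrite st.
rewrite big_split /= -mulr_sumr.
suff -> : \sum_u edge_lap k' u = 0 by rewrite mulr0 addr0.
transitivity (\sum_u 1 * edge_lap k' u).
  by apply: eq_bigr => u _; rewrite mul1r.
rewrite (sum_edge_lap (fun=> 1)) big1 // => e _.
by rewrite subrr mul0r.
Qed.

(** Take the tangents of [x ln x] at the new values [k']. Since [mass * (k - k')] is
    [eps * edge_lap k'], summation by parts turns the linear terms into the production; the [+ 1]
    cancels in differences. *)
Lemma entropy_production k k' : euler_step k k' -> (forall v, 0 <= k v) ->
  eps * \sum_e (ln (k' (head e)) - ln (k' (tail e))) *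
               (k' (head e) - k' (tail e)) <= entropy k' - entropy k.
Proof.
move=> st k0; have k'0 := euler_step_ge0 _ _ st k0.
apply: (@le_trans _ _ (\sum_v (ln (k' v) + 1) * (mass v * (k v - k' v)))).
  under [leRHS]eq_bigr => v _ do
    rewrite [mass v * _]mulrBr st [mass v * _ + _]addrC addrK mulrCA.
  rewrite -mulr_sumr sum_edge_lap; apply: ler_wpM2l; first exact: ltW.
  by apply: ler_sum => e _; rewrite [- (_ + 1)]opprD addrACA subrr addr0.
rewrite /entropy opprK addrC -sumrB; apply: ler_sum => v _.
rewrite -mulrBr mulrCA; apply: ler_wpM2l; first exact/ltW/mass_gt0.
(* There is no tangent at [k' v = 0]; but then [v] is a minimum of [k'], and the step equation
   forces [k v = 0]. *)
have := k'0 v; rewrite le_eqVlt => /predU1P[z|pos]; last exact: xlnx_tangent.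
have h0 : edge_lap k' v <= 0.
  by apply: sumr_le0 => e _; apply: edge_lap_min_term => w; rewrite -z.
have kv : k v = 0.
  apply/eqP; rewrite eq_le k0 andbT -(pmulr_rle0 _ (mass_gt0 v)) st -z mulr0 add0r.
  by rewrite pmulr_rle0.
by rewrite kv -z subrr !mul0r mulr0 subrr.
Qed.

Lemma entropy_variation k k' : euler_step k k' -> (forall v, 0 <= k v) ->
  \sum_v mass v * k v = 1 ->
  2 * eps * variation k' ^+ 2 <= entropy k' - entropy k.
Proof.
move=> st k0 k1; have k'0 := euler_step_ge0 _ _ st k0.
apply: le_trans (entropy_production _ _ st k0).
rewrite mulrAC mulrC; apply: ler_wpM2l; first exact: ltW.
(* The optimal parameter of the linearised Cauchy-Schwarz: as the endpoint sums total at most 1, the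
   linear bounds add up to at least [2 * (2 * l ^+ 2 - l ^+ 2)]. *)
set l := variation k'.
have S1 : \sum_e (k' (head e) + k' (tail e)) <= 1.
  rewrite -k1 -(euler_step_mass _ _ st) -sum_degree.
  by apply: ler_sum => v _; rewrite ler_wpM2r // lerDl ltW.
apply: (@le_trans _ _ (\sum_e 2 * (2 * l * `|k' (head e) - k' (tail e)|
                          - l ^+ 2 * (k' (head e) + k' (tail e))))).
  rewrite -mulr_sumr sumrB -!mulr_sumr -/(variation k') -/l.
  have := ler_wpM2l (sqr_ge0 l) S1; lra.
apply: ler_sum => e _.
have supp := euler_step_support _ _ st k0 e.
have := k'0 (head e); rewrite le_eqVlt => /predU1P[/esym z|hp].
  by rewrite z (supp.1 z) !subrr addr0 normr0 !mulr0 subrr mulr0.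
have := k'0 (tail e); rewrite le_eqVlt => /predU1P[/esym z|tp].
  by rewrite (supp.2 z) ltxx in hp.
exact: log_mean_ge_linear.
Qed.

(** Gibbs' inequality: tangents at the uniform density, the inverse of the total mass. *)
Lemma entropy_le k : (forall v, 0 <= k v) -> \sum_v mass v * k v = 1 ->
  entropy k <= ln (\sum_v mass v).
Proof.
move=> k0 k1; set M := \sum_v mass v.
have M0 : 0 < M.
  rewrite lt_def sumr_ge0 ?andbT => [|v _]; last exact/ltW/mass_gt0.
  apply: contra_neq (oner_neq0 R) => z; rewrite -k1.
  apply: big1 => v _; rewrite (psumr_eq0P _ z) ?mul0r // => w _.
  exact/ltW/mass_gt0.
have : \sum_v mass v * ((ln M^-1 + 1) * (k v - M^-1)) <=
       \sum_v mass v * (k v * ln (k v) - M^-1 * ln M^-1).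
  apply: ler_sum => v _; apply: ler_wpM2l; first exact/ltW/mass_gt0.
  by apply: xlnx_tangent; rewrite ?invr_gt0.
under eq_bigr => v _ do rewrite mulrCA mulrBr.
under [leRHS]eq_bigr => v _ do rewrite mulrBr.
rewrite -mulr_sumr !sumrB -!mulr_suml k1 -/M mulrA divff ?gt_eqF //.
by rewrite subrr mulr0 mul1r lnV ?posrE // /entropy; lra.
Qed.

(** Jensen for [x ln x]: tangents at the average mass [M / n], where the linear terms sum to
    zero. *)
Lemma sum_mass_ln : (0 < n)%N ->
  (\sum_v mass v) * ln (\sum_v mass v) - \sum_v mass v * ln (mass v)
    <= (\sum_v mass v) * ln n%:R.
Proof.
move=> n0; set M := \sum_v mass v.
have n0' : 0 < n%:R :> R by rewrite ltr0n.
have M0 : 0 < M.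
  by rewrite /M sum_mass ltr_wpDl ?mulr_ge0 ?ler0n // mulr_gt0.
have : \sum_v (ln (M / n%:R) + 1) * (mass v - M / n%:R) <=
       \sum_v (mass v * ln (mass v) - M / n%:R * ln (M / n%:R)).
  by apply: ler_sum => v _; apply: xlnx_tangent; rewrite ?divr_gt0 // ltW // mass_gt0.
rewrite -mulr_sumr !sumrB !sumr_const card_ord -/M.
rewrite -[M / _ *+ n]mulr_natr -[(_ * ln _) *+ n]mulr_natr ln_div ?posrE //.
rewrite divfK ?gt_eqF // subrr mulr0 [_ * n%:R]mulrAC divfK ?gt_eqF //.
lra.
Qed.

End Euler.
End Graph.

(** * Entrywise l1 norm, and small terms of a bounded series *)

Definition norm11 {R : realType} {p q : nat} (X : 'M[R]_(p, q)) : R :=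
  \sum_i \sum_j `|X i j|.

Lemma norm11D {R : realType} {p q : nat} (X Y : 'M[R]_(p, q)) :
  norm11 (X + Y) <= norm11 X + norm11 Y.
Proof.
rewrite -big_split; apply: ler_sum => i _; rewrite -big_split.
by apply: ler_sum => j _; rewrite mxE ler_normD.
Qed.

Lemma norm11Z {R : realType} {p q : nat} (a : R) (X : 'M[R]_(p, q)) :
  norm11 (a *: X) = `|a| * norm11 X.
Proof.
rewrite mulr_sumr; apply: eq_bigr => i _; rewrite mulr_sumr.
by apply: eq_bigr => j _; rewrite mxE normrM.
Qed.

Lemma norm11M {R : realType} {p q r : nat} (X : 'M[R]_(p, q)) (Y : 'M_(q, r)) :
  norm11 (X *m Y) <= \sum_v (\sum_i `|X i v|) * (\sum_j `|Y v j|).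
Proof.
apply: (@le_trans _ _ (\sum_i \sum_j \sum_v `|X i v| * `|Y v j|)).
  apply: ler_sum => i _; apply: ler_sum => j _; rewrite mxE.
  apply: le_trans (ler_norm_sum _ _ _) _.
  by apply: ler_sum => v _; rewrite normrM.
rewrite le_eqVlt; apply/orP; left; apply/eqP.
under eq_bigr => i _ do rewrite exchange_big /=.
rewrite exchange_big /=; apply: eq_bigr => v _.
by rewrite mulr_suml; apply: eq_bigr => i _; rewrite mulr_sumr.
Qed.

(** Otherwise the terms of index 2, 4, ..., 2N with [N > C / d] already sum to more than [C]. Even
    indices match the paired times of [sum_norm11_heat]. *)
Lemma small_even_term {R : realType} (a : nat -> R) (C d : R) :
  (forall s, 0 <= a s) -> (forall N, \sum_(s < N) a s.+1 <= C) -> 0 < d ->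
  exists S, a S.*2 <= d.
Proof.
move=> a0 aC d0; pose N := Num.bound (C / d).
have C0 : 0 <= C by have := aC 0%N; rewrite big_ord0.
have NC : C < N%:R * d.
  by rewrite -ltr_pdivrMr // archi_boundP // divr_ge0 // ltW.
have [/existsP[S aS]|none] := boolP [exists S : 'I_N, a S.+1.*2 <= d].
  by exists S.+1.
have big S : (S <= N)%N -> S%:R * d <= \sum_(s < S.*2) a s.+1.
  elim: S => [|S IH] SN; first by rewrite mul0r big_ord0.
  rewrite doubleS !big_ord_recr /= -natr1 mulrDl mul1r -addrA.
  apply: lerD; first exact/IH/ltnW.
  have := none; rewrite negb_exists => /forallP /(_ (Ordinal SN)) /=.
  rewrite -ltNge => /ltW /le_trans -> //.
  by rewrite doubleS lerDr.
by have := lt_le_trans NC (le_trans (big N (leqnn N)) (aC _)); rewrite ltxx.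
Qed.

(** * The discrete heat kernel *)

Section HeatKernel.
Context {R : realType} {n m : nat}.
Variables (tail head : 'I_m -> 'I_n) (eps : R).
Hypothesis eps_gt0 : 0 < eps.

Local Notation B := (incidence R tail head).
Local Notation L := (laplacian R tail head).
Local Notation mass := (mass tail head eps).
Local Notation M := (\sum_v mass v).

Definition mass_mx : 'M[R]_n := diag_mx (\row_v mass v).
Definition mass_inv : 'M[R]_n := diag_mx (\row_v (mass v)^-1).
Definition euler_mx : 'M[R]_n := mass_mx + eps *: L.

(* The column v of heat s is the s-th Euler iterate started at 1_v / mass v. *)
Fixpoint heat (s : nat) : 'M[R]_n :=
  if s is s'.+1 then invmx euler_mx *m mass_mx *m heat s' else mass_inv.

Definition heat_var s v : R := variation tail head (fun u => heat s u v).

Definition heat_energy s : R := \sum_v mass v * heat_var s v ^+ 2.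

Lemma mass_mxK p (X : 'M_(n, p)) : mass_inv *m (mass_mx *m X) = X.
Proof.
apply/matrixP => i j; rewrite !mul_diag_mx !mxE mulKf //.
by rewrite gt_eqF // mass_gt0.
Qed.

Lemma mass_invK p (X : 'M_(n, p)) : mass_mx *m (mass_inv *m X) = X.
Proof.
apply/matrixP => i j; rewrite !mul_diag_mx !mxE mulVKf //.
by rewrite gt_eqF // mass_gt0.
Qed.

Lemma mul_incidence p (X : 'M_(n, p)) e j :
  (B *m X) e j = X (head e) j - X (tail e) j.
Proof. by rewrite mxE (sum_incidence _ _ (X^~ j)). Qed.

Lemma mul_euler_mx p (X : 'M_(n, p)) u j : (euler_mx *m X) u j =
  mass u * X u j + eps * edge_lap tail head (X^~ j) u.
Proof.
rewrite mulmxDl mul_diag_mx -scalemxAl -mulmxA !mxE; congr (_ + _ * _).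
by apply: eq_bigr => e _; rewrite mul_incidence mxE.
Qed.

Lemma tr_euler_mx : euler_mx^T = euler_mx.
Proof. by rewrite linearD linearZ /= tr_diag_mx trmx_mul trmxK. Qed.

(** If [y] is in the kernel, then [y] and [- y] are both Euler steps from 0, hence both
    nonnegative. *)
Lemma euler_mx_unit : euler_mx \in unitmx.
Proof.
rewrite -row_free_unit; apply: inj_row_free => x.
rewrite -tr_euler_mx -{1}[x]trmxK -trmx_mul => /(congr1 trmx).
rewrite trmxK trmx0 => Ax; set y := x^T in Ax.
have st : euler_step tail head eps (fun=> 0) (y^~ 0).
  by move=> u; rewrite -mul_euler_mx Ax mxE mulr0.
have stN : euler_step tail head eps (fun=> 0) ((- y)^~ 0).
  by move=> u; rewrite -mul_euler_mx mulmxN Ax oppr0 mxE mulr0.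
have y0 := euler_step_ge0 _ _ _ eps_gt0 _ _ st (fun=> lexx 0).
have yN0 := euler_step_ge0 _ _ _ eps_gt0 _ _ stN (fun=> lexx 0).
apply/rowP => v; apply/eqP; have := y0 v; have := yN0 v.
by rewrite !mxE oppr_ge0 => l g; rewrite eq_le l g.
Qed.

Lemma heat_step s v :
  euler_step tail head eps (fun u => heat s u v) (fun u => heat s.+1 u v).
Proof.
move=> u; rewrite -mul_euler_mx /= -mulmxA mulKVmx ?euler_mx_unit //.
by rewrite mul_diag_mx !mxE.
Qed.

Lemma heat0E u v : heat 0 u v = (u == v)%:R / mass v.
Proof. by rewrite !mxE; case: eqVneq => [->|_]; rewrite ?mul1r ?mul0r. Qed.

Lemma heat_ge0 s u v : 0 <= heat s u v.
Proof.
elim: s u => [|s IH] u.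
  by rewrite heat0E divr_ge0 ?ler0n // ltW // mass_gt0.
exact: (euler_step_ge0 _ _ _ eps_gt0 _ _ (heat_step s v) IH).
Qed.

Lemma heat_mass s v : \sum_u mass u * heat s u v = 1.
Proof.
elim: s => [|s IH]; last by rewrite (euler_step_mass _ _ _ _ _ (heat_step s v)).
under eq_bigr => u _ do rewrite heat0E mulrCA.
by rewrite sum_delta divff // gt_eqF // mass_gt0.
Qed.

Lemma heatS s : heat s.+1 = invmx euler_mx *m mass_mx *m heat s.
Proof. by []. Qed.

Lemma heatSr s : heat s.+1 = heat s *m mass_mx *m invmx euler_mx.
Proof.
elim: s => [|s IH]; last by rewrite heatS {1}IH [in RHS]heatS !mulmxA.
by rewrite heatS -!mulmxA mass_mxK -[heat 0]mulmx1 mass_invK mulmx1.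
Qed.

Lemma heatD s t : heat (s + t) = heat s *m mass_mx *m heat t.
Proof.
elim: s => [|s IH]; first by rewrite add0n /= -mulmxA mass_mxK.
by rewrite addSn !heatS IH !mulmxA.
Qed.

Lemma tr_heat s : (heat s)^T = heat s.
Proof.
elim: s => [|s IH]; first exact: tr_diag_mx.
rewrite {1}heatSr heatS !trmx_mul IH trmx_inv tr_euler_mx.
by rewrite tr_diag_mx mulmxA.
Qed.

Lemma heat_varE s v : heat_var s v = \sum_e `|(B *m heat s) e v|.
Proof. by apply: eq_bigr => e _; rewrite mul_incidence. Qed.

(** * Heat kernel between edges, summed over time *)

(** The semigroup law [heatD] and symmetry factor the matrix through an intermediate vertex [v] at
    time [s]. *)
Lemma norm11_incidence_heat s t : norm11 (B *m heat (s + t) *m B^T) <=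
  \sum_v mass v * (heat_var s v * heat_var t v).
Proof.
have -> : B *m heat (s + t) *m B^T = (B *m heat s) *m (mass_mx *m (B *m heat t)^T).
  by rewrite heatD trmx_mul tr_heat !mulmxA.
apply: le_trans (norm11M _ _) _; apply: ler_sum => v _.
rewrite mulrCA -heat_varE ler_wpM2l ?heat_varE ?sumr_ge0 //.
rewrite mulr_sumr; apply: ler_sum => e _.
by rewrite mul_diag_mx !mxE normrM ger0_norm // ltW // mass_gt0.
Qed.

Lemma norm11_heat_even s :
  norm11 (B *m heat (s + s) *m B^T) <= heat_energy s.
Proof. exact: norm11_incidence_heat. Qed.

Lemma norm11_heat_odd s : norm11 (B *m heat (s + s.+1) *m B^T) <=
  (heat_energy s + heat_energy s.+1) / 2.
Proof.
apply: le_trans (norm11_incidence_heat _ _) _.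
rewrite -big_split /= mulr_suml; apply: ler_sum => v _.
rewrite -mulrDr -mulrA; apply: ler_wpM2l; first exact/ltW/mass_gt0.
have := sqr_ge0 (heat_var s v - heat_var s.+1 v); nra.
Qed.

Lemma heat_energy_ge0 s : 0 <= heat_energy s.
Proof.
by apply: sumr_ge0 => v _; rewrite mulr_ge0 ?sqr_ge0 // ltW // mass_gt0.
Qed.

(** Time 0 precedes the first entropy gain; this crude bound suffices since it is later multiplied
    by [eps / 2]. *)
Lemma heat_energy0_le : heat_energy 0 <= M.
Proof.
apply: ler_sum => v _; rewrite ler_piMr //; first exact/ltW/mass_gt0.
have v0 : 0 <= heat_var 0 v by rewrite heat_varE sumr_ge0.
rewrite expr_le1 // -(heat_mass 0 v); apply: variation_le_mass => //.
by move=> u; apply: heat_ge0.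
Qed.

(** The entropy gains telescope; the initial point mass at [v] has entropy [ln (mass v)]. *)
Lemma sum_heat_var N v :
  \sum_(s < N) 2 * eps * heat_var s.+1 v ^+ 2 <= ln M - ln (mass v).
Proof.
have step s := entropy_variation _ _ _ eps_gt0 _ _ (heat_step s v)
  (fun u => heat_ge0 s u v) (heat_mass s v).
apply: (@le_trans _ _ (entropy tail head eps (fun u => heat N u v)
                       - entropy tail head eps (fun u => heat 0 u v))).
  elim: N => [|N IH]; first by rewrite big_ord0 subrr.
  by rewrite big_ord_recr /=; have := step N; rewrite /heat_var /=; lra.
apply: lerB.
  exact: (entropy_le _ _ _ eps_gt0 _ (fun u => heat_ge0 N u v) (heat_mass N v)).
rewrite /entropy (bigD1 v) //= big1 => [|u /negbTE uv]; last first.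
  by rewrite -/(heat 0) heat0E uv !mul0r mulr0.
rewrite -/(heat 0) heat0E eqxx mul1r addr0 lnV ?posrE ?mass_gt0 //.
by rewrite mulVKf ?opprK // gt_eqF // mass_gt0.
Qed.

Lemma sum_heat_energy N : (0 < n)%N ->
  2 * eps * \sum_(s < N) heat_energy s.+1 <= M * ln n%:R.
Proof.
move=> n0; rewrite /heat_energy exchange_big /= mulr_sumr.
apply: le_trans (sum_mass_ln _ _ _ eps_gt0 n0).
rewrite mulr_suml -sumrB; apply: ler_sum => v _.
rewrite -mulr_sumr mulrCA -mulrBr; apply: ler_wpM2l; first exact/ltW/mass_gt0.
by rewrite mulr_sumr; apply: sum_heat_var.
Qed.

Lemma sum_norm11_heat S :
  \sum_(t < S.*2) norm11 (B *m heat t.+1 *m B^T) <=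
  heat_energy 0 / 2 + 2 * \sum_(s < S) heat_energy s.+1.
Proof.
(* Times [2S+1] and [2S+2] cost at most [E_S / 2 + 3 E_(S+1) / 2], which is [2 E_(S+1)] plus the
   telescoping [(E_S - E_(S+1)) / 2]. *)
suff : \sum_(t < S.*2) norm11 (B *m heat t.+1 *m B^T) <=
    (heat_energy 0 - heat_energy S) / 2 + 2 * \sum_(s < S) heat_energy s.+1.
  by have := heat_energy_ge0 S; lra.
elim: S => [|S IH]; first by rewrite !big_ord0; lra.
rewrite doubleS !big_ord_recr /=.
have := norm11_heat_odd S; have := norm11_heat_even S.+1.
by rewrite !addnS addSn addnn; lra.
Qed.

(** Since [heat T *m mass_mx = heat T.+1 *m euler_mx], each step splits off one [eps]-term, in which
    [L *m Y] becomes [B^T]. *)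
Lemma heat_telescope (Y : 'M[R]_(n, m)) (T : nat) : L *m Y = B^T ->
  B *m Y = B *m heat T *m mass_mx *m Y
           + eps *: \sum_(t < T) B *m heat t.+1 *m B^T.
Proof.
move=> LY; elim: T => [|T IH].
  by rewrite big_ord0 scaler0 addr0 -!mulmxA mass_mxK.
rewrite {1}IH big_ord_recr /= scalerDr [LHS]addrC [RHS]addrCA; congr (_ + _).
rewrite -heatS -LY.
have heatA : heat T *m mass_mx = heat T.+1 *m euler_mx.
  by rewrite heatSr mulmxKV // euler_mx_unit.
rewrite -[B *m heat T *m _]mulmxA heatA /euler_mx !mulmxDr mulmxDl.
by rewrite -!scalemxAr -scalemxAl !mulmxA.
Qed.

Lemma norm11_green_le (Y : 'M[R]_(n, m)) : (0 < n)%N -> L *m Y = B^T ->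
  norm11 (B *m Y) <= M * (ln n%:R + eps / 2).
Proof.
move=> n0 LY; apply/ler_addgt0Pr => d d0.
pose y v := \sum_f `|Y v f|.
pose C := \sum_v mass v * y v ^+ 2.
have C0 : 0 <= C.
  by apply: sumr_ge0 => v _; rewrite mulr_ge0 ?sqr_ge0 // ltW // mass_gt0.
(* Weight for AM-GM on the remainder, chosen so that [h * C <= d]; the [+ 1] covers [C = 0]. *)
pose h := d / (C + 1).
have h0 : 0 < h by rewrite divr_gt0 // ltr_wpDl.
have hC : h * C <= d by rewrite /h mulrAC ler_pdivrMr ?ltr_wpDl // ler_pM2l // lerDl.
have eps2 : 0 < 2 * eps by rewrite mulr_gt0.
(* The energies have bounded partial sums, so at some even time the energy divided by [h] is at most
   [d]. *)
have [S aS] : exists S, heat_energy S.*2 <= d * h.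
  apply: (small_even_term _ (M * ln n%:R / (2 * eps))) => [s|N|].
  - exact: heat_energy_ge0.
  - by rewrite ler_pdivlMr // mulrC; apply: sum_heat_energy.
  - by rewrite mulr_gt0.
rewrite (heat_telescope _ S.*2 LY); apply: le_trans (norm11D _ _) _.
have rem : norm11 (B *m heat S.*2 *m mass_mx *m Y) <= d.
  rewrite -mulmxA; apply: le_trans (norm11M _ _) _.
  apply: (@le_trans _ _ (\sum_v mass v * ((heat_var S.*2 v ^+ 2 / h + h * y v ^+ 2) / 2))).
    apply: ler_sum => v _; rewrite -heat_varE.
    have -> : \sum_j `|(mass_mx *m Y) v j| = mass v * y v.
      rewrite mulr_sumr; apply: eq_bigr => j _.
      by rewrite mul_diag_mx !mxE normrM gtr0_norm // mass_gt0.
    rewrite mulrCA; apply: ler_wpM2l; first exact/ltW/mass_gt0.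
    rewrite ler_pdivlMr // -(ler_pM2r h0) mulrDl divfK ?gt_eqF //.
    have := sqr_ge0 (heat_var S.*2 v - h * y v); nra.
  have -> : \sum_v mass v * ((heat_var S.*2 v ^+ 2 / h + h * y v ^+ 2) / 2) =
      (heat_energy S.*2 / h + h * C) / 2.
    rewrite mulr_suml mulr_sumr -big_split /= mulr_suml.
    by apply: eq_bigr => v _; ring.
  have : heat_energy S.*2 / h <= d by rewrite ler_pdivrMr.
  lra.
have sum11 : norm11 (eps *: \sum_(t < S.*2) B *m heat t.+1 *m B^T) <=
    eps * \sum_(t < S.*2) norm11 (B *m heat t.+1 *m B^T).
  rewrite norm11Z gtr0_norm // ler_pM2l //.
  elim/big_ind2 : _ => // [|x1 x2 y1 y2 h1 h2].
    by rewrite /norm11 big1 // => i _; rewrite big1 // => j _; rewrite mxE normr0.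
  by apply: le_trans (norm11D _ _) _; apply: lerD.
have := ler_wpM2l (ltW eps_gt0) (sum_norm11_heat S).
have := ler_wpM2l (ltW eps_gt0) heat_energy0_le.
have := sum_heat_energy S n0.
lra.
Qed.

End HeatKernel.

(** * The pseudoinverse and the limit of small [eps] *)

Lemma mulmx_tr_eq0 {R : realType} {p q : nat} (X : 'M[R]_(p, q)) :
  X *m X^T = 0 -> X = 0.
Proof.
move=> XX; apply/matrixP => i j; apply/eqP; rewrite mxE -sqrf_eq0 expr2.
have /matrixP/(_ i i) := XX; rewrite !mxE => sum0; apply/eqP.
have ge0 k : true -> 0 <= X i k * X^T k i by rewrite mxE -expr2 sqr_ge0.
suff : X i j * X^T j i = 0 by rewrite mxE.
exact: (psumr_eq0P ge0).
Qed.

(** The defect [X] satisfies [X *m B = 0], and its transpose is [B] times a matrix, so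
    [X *m X^T = 0]. *)
Lemma laplacian_pinv_incidence {R : realType} {n m : nat}
  (tail head : 'I_m -> 'I_n) (Lp : 'M[R]_n) :
  laplacian R tail head *m Lp *m laplacian R tail head = laplacian R tail head ->
  laplacian R tail head *m (Lp *m (incidence R tail head)^T)
    = (incidence R tail head)^T.
Proof.
set B := incidence R tail head; set L := laplacian R tail head => LLpL.
pose X := L *m Lp *m B^T - B^T.
have XB : X *m B = 0.
  have -> : X *m B = L *m Lp *m L - L by rewrite mulmxBl -[L *m Lp *m B^T *m B]mulmxA.
  by rewrite LLpL subrr.
apply/eqP; rewrite -subr_eq0 mulmxA -/X; apply/eqP/mulmx_tr_eq0.
by rewrite {2}/X linearB /= trmxK trmx_mul trmxK mulmxBr mulmxA XB mul0mx subrr.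
Qed.

Lemma sum_norm1_elec_flow {R : realType} {n m : nat}
  (tail head : 'I_m -> 'I_n) (Lp : 'M[R]_n) :
  \sum_(e < m) norm1 (elec_flow tail head Lp e) =
  norm11 (incidence R tail head *m (Lp *m (incidence R tail head)^T)).
Proof.
rewrite /norm11 exchange_big /=; apply: eq_bigr => e _; apply: eq_bigr => f _.
rewrite mulmxA /elec_flow; congr `| _ |.
by rewrite !mxE; apply: eq_bigr => v _; rewrite !mxE.
Qed.

Theorem theorem1p1 (R : realType) (n m : nat) (tail head : 'I_m -> 'I_n)
  (Lp : 'M[R]_n) :
  (2 <= n)%N -> (1 <= m)%N -> loopless tail head ->
  moore_penrose (laplacian R tail head) Lp ->
  (m%:R)^-1 * \sum_(e < m) norm1 (elec_flow tail head Lp e)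
    <= 2 * ln (n%:R : R).
Proof.
move=> n2 m1 _ [LLpL _ _ _].
have m0 : 0 < m%:R :> R by rewrite ltr0n.
have n0 : 0 <= n%:R :> R by rewrite ler0n.
have ln0 : 0 <= ln (n%:R : R) by rewrite ln_ge0 // ler1n ltnW.
rewrite mulrC ler_pdivrMr // sum_norm1_elec_flow.
apply/ler_addgt0Pr => d d0.
(* Expanding [(2 m + n eps) (ln n + eps / 2)] leaves an excess over [2 m ln n] of at most [eps * C]
   once [eps <= 1]. *)
pose C : R := m%:R + n%:R * (ln n%:R + 1).
have C0 : 0 < C by rewrite ltr_wpDr // mulr_ge0 // addr_ge0.
pose eps := Num.min 1 (d / C).
have eps0 : 0 < eps by rewrite lt_min ltr01 divr_gt0.
have eps1 : eps <= 1 by rewrite ge_min lexx.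
have epsC : eps * C <= d by rewrite -ler_pdivlMr // ge_min lexx orbT.
have := norm11_green_le _ _ _ eps0 _ (ltnW n2) (laplacian_pinv_incidence _ _ _ LLpL).
rewrite sum_mass => /le_trans; apply.
have e2 : n%:R * eps * (eps / 2) <= n%:R * eps.
  by apply: ler_piMr; [apply: mulr_ge0 => //; exact: ltW | lra].
move: epsC; rewrite /C; lra.
Qed.
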